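(* Let $X_1,X_2,\dots$ be i.i.d. real-valued random variables with common distribution $F$, let $f_c:\mathbb{R}^2\to\mathbb{R}$ be Borel measurable with $f_c(x,y)=f_c(y,x)$, let $B\subset\mathbb{R}$ be a Borel set, and fix a real number $w$. Set $h_D(x,y)=I_B(f_c(x,y))$, $h_T(x,y,z)=I_B(f_c(x,y))I_B(f_c(y,z))I_B(f_c(z,x))$, $h_V(x,y,z)=I_B(f_c(x,y))I_B(f_c(x,z))$. For $x\in\mathbb{R}$ and $n\ge 1$ define $$T_n(1;x)=\sum_{2\le j<k\le n}h_T(x,X_j,X_k),\qquad V_n(1;x)=\sum_{2\le j<k\le n}h_V(x,X_j,X_k),$$ $$C_n(1;x)=\frac{T_n(1;x)}{V_n(1;x)}I_{\{V_n(1;x)\ge 1\}}+w\, I_{\{V_n(1;x)=0\}},$$ and let $C_n(1)=C_n(1;X_1)$ (this is the local clustering coefficient of vertex $1$ in the random graph on vertices $1,\dots,n$ where $i\ne j$ are adjacent iff $f_c(X_i,X_j)\in B$, with value $w$ when vertex $1$ has degree $0$ or $1$). Further define $E_D(x)=\int_{\mathbb{R}}h_D(x,y)F(dy)$, $E_T(x)=\int_{\mathbb{R}}\int_{\mathbb{R}}h_T(x,y,z)F(dy)F(dz)$, $$C(1;x)=\frac{E_T(x)}{E_D(x)^2}I_{\{E_D(x)>0\}}+w\,I_{\{E_D(x)=0\}},$$ and $C(1)=C(1;X_1)$. Then as $n\to\infty$: (i) for every $x\in\mathbb{R}$, $C_n(1;x)\to C(1;x)$ almost surely; (ii) $C_n(1)\to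 C(1)$ almost surely.
   Context: $I_A$ denotes the indicator function of the set $A$. *)

(* Defs.v *)
From HB Require Import structures.
From mathcomp Require Import all_boot all_order all_algebra.
From mathcomp Require Import all_classical all_reals all_analysis.
Set Implicit Arguments. Unset Strict Implicit. Unset Printing Implicit Defensive.
Import Order.TTheory GRing.Theory Num.Theory.
Import numFieldNormedType.Exports.
Local Open Scope classical_set_scope.
Local Open Scope ring_scope.

Definition mutually_independent_rv d (T : measurableType d) (R : realType)
    (P : probability T R) (X : nat -> T -> R) : Prop :=
  forall (s : seq nat) (A : nat -> set R),
    uniq s -> (forall i, measurable (A i)) ->
    P (\big[setI/setT]_(i <- s) (X i @^-1` A i)) =
    (\prod_(i <- s) P (X i @^-1` A i))%E.

(* X_0, X_1, ... are i.i.d. with common distribution F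
   (index 0 here corresponds to X_1 of the paper). *)
Definition iid_with_law d (T : measurableType d) (R : realType)
    (P : probability T R) (F : probability R R) (X : nat -> T -> R) : Prop :=
  [/\ forall i, measurable_fun setT (X i),
      mutually_independent_rv P X &
      forall i (A : set R), measurable A -> P (X i @^-1` A) = F A].

Section Clustering.
Variables (R : realType) (fc : R -> R -> R) (B : set R) (w : R).

Definition hD (x y : R) : R := \1_B (fc x y).
Definition hT (x y z : R) : R := \1_B (fc x y) * \1_B (fc y z) * \1_B (fc z x).
Definition hV (x y z : R) : R := \1_B (fc x y) * \1_B (fc x z).

(* Vertices 1..n of the paper correspond to indices 0..n-1 of xs;
   vertex 1 is index 0, and 2 <= j < k <= n becomes 1 <= j < k < n. *)
Definition Tn (n : nat) (xs : nat -> R) (x : R) : R :=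
  \sum_(1 <= j < n) \sum_(j.+1 <= k < n) hT x (xs j) (xs k).
Definition Vn (n : nat) (xs : nat -> R) (x : R) : R :=
  \sum_(1 <= j < n) \sum_(j.+1 <= k < n) hV x (xs j) (xs k).

Definition Cn (n : nat) (xs : nat -> R) (x : R) : R :=
  Tn n xs x / Vn n xs x * (nat_of_bool (1 <= Vn n xs x)%R)%:R + w * (nat_of_bool (Vn n xs x == 0)%R)%:R.

Definition ED (F : probability R R) (x : R) : R :=
  Rintegral F setT (fun y => hD x y).
Definition ET (F : probability R R) (x : R) : R :=
  Rintegral F setT (fun z => Rintegral F setT (fun y => hT x y z)).

Definition Clim (F : probability R R) (x : R) : R :=
  ET F x / (ED F x) ^+ 2 * (nat_of_bool (0 < ED F x)%R)%:R + w * (nat_of_bool (ED F x == 0)%R)%:R.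
End Clustering.

(* Main.v *)
(* A vertex with law independent of X_2, X_3, ... (either the deterministic x or
   X_1 itself) is treated uniformly as a random variable Z.  For a kernel
   0 <= h <= 1 with conditional mean theta(Z) = E[h(Z, X_j, X_k) | Z], the
   centered terms h(Z, X_j, X_k) - theta(Z) are uncorrelated as soon as their
   index pairs are disjoint, so their sum over the pairs below n has second
   moment at most 4 n^3.  Along n = m^2 this gives almost sure convergence of the
   U-statistic divided by n^2, and monotonicity in n fills the gaps.  Applied to
   h_T and h_V (whose mean is E_D^2) this gives the limit of T_n / V_n when
   E_D(Z) > 0; when E_D(Z) = 0, almost surely no edge at the vertex ever appears. *)

Require Import Defs.
From HB Require Import structures.
From mathcomp Require Import all_boot all_order all_algebra.
From mathcomp Require Import all_classical all_reals all_analysis measurable_realfun.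
From mathcomp Require Import ring lra.
Import Order.TTheory GRing.Theory Num.Theory.
Import numFieldNormedType.Exports.
Local Open Scope classical_set_scope.
Local Open Scope ring_scope.

(** * Bounded measurable functions and their integrals *)

(** The bound holds everywhere, so such functions are integrable for every finite measure and stay
    in the class under arithmetic and measurable substitution; integrability conditions below reduce
    to membership here. *)
Definition bounded_measurable {d} {T : measurableType d} {R : realType}
    (f : T -> R) : Prop :=
  measurable_fun setT f /\ exists M, forall x, `|f x| <= M.

Section BoundedMeasurable.
Context {d} {T : measurableType d} {R : realType}.
Implicit Types f g : T -> R.

Lemma bounded_measurable_cst (c : R) : bounded_measurable (fun _ : T => c).
Proof. by split; [exact: measurable_cst | exists `|c|]. Qed.

Lemma bounded_measurableD f g : bounded_measurable f -> bounded_measurable g ->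
  bounded_measurable (fun x => f x + g x).
Proof.
move=> [mf [M fM]] [mg [N gN]]; split; first exact: measurable_funD.
by exists (M + N) => x; rewrite (le_trans (ler_normD _ _))// lerD.
Qed.

Lemma bounded_measurableB f g : bounded_measurable f -> bounded_measurable g ->
  bounded_measurable (fun x => f x - g x).
Proof.
move=> [mf [M fM]] [mg [N gN]]; split; first exact: measurable_funB.
by exists (M + N) => x; rewrite (le_trans (ler_normB _ _))// lerD.
Qed.

Lemma bounded_measurableM f g : bounded_measurable f -> bounded_measurable g ->
  bounded_measurable (fun x => f x * g x).
Proof.
move=> [mf [M fM]] [mg [N gN]]; split; first exact: measurable_funM.
by exists (M * N) => x; rewrite normrM ler_pM.
Qed.

Lemma bounded_measurable_sum (I : Type) (s : seq I) (Q : pred I)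
    (f : I -> T -> R) : (forall i, bounded_measurable (f i)) ->
  bounded_measurable (fun x => \sum_(i <- s | Q i) f i x).
Proof.
move=> bf; elim: s => [|i s IH].
  rewrite (_ : (fun _ => _) = (fun _ => 0)); first exact: bounded_measurable_cst.
  by apply/funext => x; rewrite big_nil.
case Qi : (Q i); last first.
  rewrite (_ : (fun _ => _) = (fun x => \sum_(j <- s | Q j) f j x)) //.
  by apply/funext => x; rewrite big_cons Qi.
rewrite (_ : (fun _ => _) = (fun x => f i x + \sum_(j <- s | Q j) f j x)).
  exact: bounded_measurableD.
by apply/funext => x; rewrite big_cons Qi.
Qed.

Lemma bounded_measurable_comp {d'} {S : measurableType d'} (f : T -> R)
    (u : S -> T) : measurable_fun setT u -> bounded_measurable f ->
  bounded_measurable (fun x => f (u x)).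
Proof.
move=> mu [mf [M fM]]; split; first exact: (measurableT_comp mf mu).
by exists M => x; exact: fM.
Qed.

Lemma bounded_measurable_integrable (mu : {finite_measure set T -> \bar R}) f :
  bounded_measurable f -> mu.-integrable setT (EFin \o f).
Proof.
move=> [mf [M fM]]; apply: measurable_bounded_integrable => //.
  exact: fin_num_fun_lty.
by exists M; split; [exact: num_real | move=> N MN x _; exact/(le_trans (fM x))/ltW].
Qed.

Lemma Rintegral_sum (mu : {finite_measure set T -> \bar R}) (I : Type)
    (s : seq I) (Q : pred I) (f : I -> T -> R) :
  (forall i, bounded_measurable (f i)) ->
  \int[mu]_x (\sum_(i <- s | Q i) f i x) = \sum_(i <- s | Q i) \int[mu]_x f i x.
Proof.
move=> bf; elim: s => [|i s IH].
  by under eq_Rintegral do rewrite big_nil; rewrite big_nil Rintegral_cst// mul0r.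
under eq_Rintegral do rewrite big_cons; rewrite big_cons.
case: ifP => // _; rewrite RintegralD ?IH//; apply: bounded_measurable_integrable => //.
exact: bounded_measurable_sum.
Qed.

Lemma Rintegral_prob_cst (P : probability T R) (c : R) : \int[P]_x c = c.
Proof. by rewrite Rintegral_cst// [X in fine X]probability_setT mulr1. Qed.

Lemma Rintegral_bound01 (P : probability T R) f :
  bounded_measurable f -> (forall x, 0 <= f x <= 1) -> 0 <= \int[P]_x f x <= 1.
Proof.
move=> bf f01; apply/andP; split.
  by apply: Rintegral_ge0 => x _; case/andP: (f01 x).
have -> : 1 = \int[P]_(x in [set: T]) (1 : R).
  by rewrite Rintegral_prob_cst.
apply: le_Rintegral => //; try exact: bounded_measurable_integrable.
  exact/bounded_measurable_integrable/bounded_measurable_cst.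
by move=> x _; case/andP: (f01 x).
Qed.

End BoundedMeasurable.

(** Integrating out one variable stays in the class, so an iterated mean can be integrated again.
    The bound [M] survives because [F] has mass one. *)
Lemma bounded_measurable_Rintegral {d d'} {T : measurableType d}
    {S : measurableType d'} {R : realType} (F : probability S R)
    (f : T * S -> R) : bounded_measurable f ->
  bounded_measurable (fun x => \int[F]_y f (x, y)).
Proof.
move=> [mf [M fM]].
have bfx x : bounded_measurable (fun y => f (x, y)).
  by apply: bounded_measurable_comp; [exact: pair1_measurable | split => //; exists M].
split; last first.
  exists M => x; apply: le_trans (le_normr_Rintegral _ _) _ => //.
    exact: bounded_measurable_integrable.
  have -> : M = \int[F]_(y in [set: S]) M.
    by rewrite Rintegral_prob_cst.
  apply: le_Rintegral => //.
    apply: bounded_measurable_integrable; have [mg [N gN]] := bfx x.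
    split; first exact: measurableT_comp.
    by exists N => y; rewrite normr_id.
  exact/bounded_measurable_integrable/bounded_measurable_cst.
(* Tonelli for [f + M >= 0] makes the section integral measurable. *)
have mg : measurable_fun setT (fun x => (\int[F]_y (f (x, y) + M)%:E)%E).
  apply: (@measurable_fun_fubini_tonelli_F _ _ _ _ _ F
    (fun z => (f z + M)%:E)).
    by apply/measurable_EFinP; apply: measurable_funD.
  by move=> z; rewrite lee_fin -lerBlDr sub0r; have := fM z; rewrite ler_norml => /andP[].
have -> : (fun x => \int[F]_y f (x, y)) =
    (fun x => fine (\int[F]_y (f (x, y) + M)%:E)%E - M).
  apply/funext => x.
  rewrite -[fine _]/(\int[F]_y (f (x, y) + M)) RintegralD//.
  - by rewrite Rintegral_prob_cst addrK.
  - exact: bounded_measurable_integrable.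
  - exact/bounded_measurable_integrable/bounded_measurable_cst.
by apply: measurable_funB => //; exact: measurableT_comp.
Qed.

(** * Independence and integration of fresh variables *)

(** Rectangles are closed under intersection, generate the product sigma-algebra and include the
    whole space, so a finite measure is determined by its values on them. *)
Lemma eq_measure_rectangles {d1 d2} {T1 : measurableType d1}
    {T2 : measurableType d2} {R : realType}
    (m1 m2 : {measure set (T1 * T2) -> \bar R}) :
  (m1 setT < +oo)%E ->
  (forall A B, measurable A -> measurable B -> m1 (A `*` B) = m2 (A `*` B)) ->
  forall C, measurable C -> m1 C = m2 C.
Proof.
move=> m1oo m12 C mC.
apply: (measure_unique [set A `*` B | A in measurable & B in measurable]
  (fun=> setT)) => //.
- by rewrite measurable_prod_measurableType.
- move=> _ _ [X1 mX1 [X2 mX2 <-]] [Y1 mY1 [Y2 mY2 <-]].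
  rewrite -setXI; exists (X1 `&` Y1); first exact: measurableI.
  by exists (X2 `&` Y2) => //; exact: measurableI.
- by move=> _; exists setT => //; exists setT => //; rewrite setXTT.
- by rewrite bigcup_const.
- by move=> _ [A mA [B mB <-]]; exact: m12.
Qed.

Section Independence.
Context {d} {Omega : measurableType d} {R : realType} (P : probability Omega R).

(** The factorization on rectangles makes the law of [(U, V)] the product of the law of [U] and [F];
    Fubini then gives the iterated integral. *)
Lemma Rintegral_indep {d1 d2} {S1 : measurableType d1} {S2 : measurableType d2}
    (U : Omega -> S1) (V : Omega -> S2) (F : probability S2 R) (f : S1 * S2 -> R) :
  measurable_fun setT U -> measurable_fun setT V ->
  (forall A B, measurable A -> measurable B ->
    P (U @^-1` A `&` V @^-1` B) = (P (U @^-1` A) * F B)%E) ->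
  bounded_measurable f ->
  \int[P]_om f (U om, V om) = \int[P]_om \int[F]_y f (U om, y).
Proof.
move=> mU mV PUV bf.
pose U' : {mfun Omega >-> S1} := HB.pack U (isMeasurableFun.Build _ _ _ _ U mU).
have mUV : measurable_fun setT (fun om => (U om, V om)).
  exact: measurable_fun_pair.
pose UV : {mfun Omega >-> (S1 * S2)%type} :=
  HB.pack (fun om => (U om, V om)) (isMeasurableFun.Build _ _ _ _ _ mUV).
have mEf : measurable_fun setT (EFin \o f).
  by apply/measurable_EFinP; case: bf.
have E1 : (\int[P]_om (f (U om, V om))%:E =
    \int[distribution P U' \x F]_z (f z)%:E)%E.
  rewrite -[LHS](@integral_distribution _ _ _ _ _ P UV (EFin \o f))//; last first.
    exact/(@bounded_measurable_integrable _ _ _ P)/bounded_measurable_comp.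
  apply: eq_measure_integral => A mA _.
  apply/esym; apply: product_measure_unique => // B C mB mC.
rewrite /Rintegral E1 -(integral12_prod_meas1 (m1 := distribution P U')); last first.
  pose PF : probability (S1 * S2)%type R := (distribution P U' \x F)%E.
  exact: (bounded_measurable_integrable PF).
have mG : bounded_measurable (fun x => \int[F]_y f (x, y)).
  exact: bounded_measurable_Rintegral.
have -> : fubini_F F (EFin \o f) = EFin \o (fun x => \int[F]_y f (x, y)).
  apply/funext => x; rewrite /fubini_F /= fineK//; apply: integrable_fin_num => //.
  apply: bounded_measurable_integrable.
  by apply: bounded_measurable_comp => //; exact: pair1_measurable.
rewrite integral_distribution//.
  by apply/measurable_EFinP; exact: mG.1.
apply: (bounded_measurable_integrable P).
exact: (bounded_measurable_comp (fun x => \int[F]_y f (x, y))).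
Qed.

(** [U] may take values in any measurable space, so that tuples of variables can be accumulated in
    it. With [A] the whole space, the formula also makes the joint law of the [X i] factorize. *)
Definition indep_of (X : nat -> Omega -> R) {d'} {S : measurableType d'}
    (U : Omega -> S) (s : seq nat) : Prop :=
  forall (A : set S) (B : nat -> set R),
    measurable A -> (forall i, measurable (B i)) ->
    P (U @^-1` A `&` \big[setI/setT]_(i <- s) (X i @^-1` B i)) =
    (P (U @^-1` A) * \prod_(i <- s) P (X i @^-1` B i))%E.

Lemma indep_of1 (X : nat -> Omega -> R) {d'} {S : measurableType d'}
    (U : Omega -> S) i : indep_of X U [:: i] ->
  forall A B, measurable A -> measurable B ->
    P (U @^-1` A `&` X i @^-1` B) = (P (U @^-1` A) * P (X i @^-1` B))%E.
Proof.
move=> H A B mA mB; have := H A (fun _ => B) mA (fun _ => mB).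
by rewrite !big_seq1.
Qed.

(** With the events [B] fixed, both sides are finite measures in [A]: the law of [(U, X i)] under
    [P] restricted to [E], and [c] times the law of [(U, X i)] under [P]. They agree on rectangles
    by the two hypotheses. *)
Lemma indep_of_pair (X : nat -> Omega -> R) {d'} {S : measurableType d'}
    (U : Omega -> S) (i : nat) (s : seq nat) :
  measurable_fun setT U -> (forall j, measurable_fun setT (X j)) ->
  i \notin s -> indep_of X U [:: i] -> indep_of X U (i :: s) ->
  indep_of X (fun om => (U om, X i om)) s.
Proof.
move=> mU mX i_s H1 H A B mA mB.
have mXB j : measurable (X j @^-1` B j) by rewrite -[X in measurable X]setTI; exact: mX.
set E := \big[setI/setT]_(j <- s) _.
have mE : measurable E by apply: bigsetI_measurable => j _.
set c := (\prod_(j <- s) _)%E.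
have mUV : measurable_fun setT (fun om => (U om, X i om)).
  exact: measurable_fun_pair.
have c0 : (0 <= c)%E by apply: prode_ge0 => j _.
have cfin : c \is a fin_num.
  by apply: prode_fin_num => j _; exact: fin_num_measure.
pose r : {nonneg R} := NngNum (fine_ge0 c0).
pose UV : {mfun Omega >-> (S * R)%type} :=
  HB.pack (fun om => (U om, X i om)) (isMeasurableFun.Build _ _ _ _ _ mUV).
pose m1_ : {measure set (S * R)%type -> \bar R} :=
  pushforward (mrestr P mE) UV.
pose m1 := m1_ mUV.
pose m2 : {measure set (S * R)%type -> \bar R} := mscale r (distribution P UV).
have m2E C : m2 C = (P ((fun om => (U om, X i om)) @^-1` C) * c)%E.
  by rewrite muleC -(fineK cfin).
suff m12 : forall C, measurable C -> m1 C = m2 C by rewrite -m2E -m12.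
apply: eq_measure_rectangles => [|C D mC mD].
  apply: le_lt_trans (ltry 1); rewrite -[m1 setT]/(P (UV @^-1` setT `&` E)).
  apply: probability_le1.
  by rewrite preimage_setT setTI.
rewrite m2E -[m1 _]/(P (UV @^-1` (C `*` D) `&` E)).
rewrite (_ : _ @^-1` (C `*` D) = U @^-1` C `&` X i @^-1` D)//.
rewrite (indep_of1 _ _ _ H1)//.
(* The event at [i] is replaced by [D]; since [i] is not in [s], the intersection and the product
   over [s] are unchanged. *)
have mB' j : measurable (if j == i then D else B j) by case: ifP.
have := H C (fun j => if j == i then D else B j) mC mB'.
rewrite !big_cons eqxx setIA muleA.
rewrite (_ : \big[setI/setT]_(j <- s) _ = E); last first.
  by apply: eq_big_seq => j js; case: eqP i_s => // <-; rewrite js.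
rewrite (_ : (\prod_(j <- s) _)%E = c)//.
by apply: eq_big_seq => j js; case: eqP i_s => // <-; rewrite js.
Qed.
End Independence.

Section IndepOff.
Context {d} {Omega : measurableType d} {R : realType} (P : probability Omega R)
  (X : nat -> Omega -> R).

(** [t] lists the indices that [U] may already depend on; all others remain fresh. *)
Definition indep_off {d'} {S : measurableType d'} (U : Omega -> S)
    (t : seq nat) : Prop :=
  forall s : seq nat, uniq s -> {in s, forall i, i \notin t} -> indep_of P X U s.

Lemma indep_off_pair {d'} {S : measurableType d'} (U : Omega -> S) (i : nat)
    (t : seq nat) : measurable_fun setT U -> (forall j, measurable_fun setT (X j)) ->
  i \notin t -> indep_off U t -> indep_off (fun om => (U om, X i om)) (i :: t).
Proof.
move=> mU mX it H s us st.
have is_ : i \notin s.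
  by apply/negP => /st; rewrite inE eqxx.
apply: indep_of_pair => //.
  by apply: H => // j; rewrite inE => /eqP ->.
apply: H => /=; first by rewrite is_.
move=> j; rewrite inE => /predU1P[->//|/st].
by rewrite inE negb_or => /andP[].
Qed.

(** A fresh variable may be replaced by an integral against [F]; this plays the role of conditioning
    on [U]. *)
Lemma Rintegral_indep_off {d'} {S : measurableType d'} (F : probability R R)
    (U : Omega -> S) (i : nat) (t : seq nat) (f : S * R -> R) :
  measurable_fun setT U -> measurable_fun setT (X i) ->
  (forall A, measurable A -> P (X i @^-1` A) = F A) ->
  i \notin t -> indep_off U t -> bounded_measurable f ->
  \int[P]_om f (U om, X i om) = \int[P]_om \int[F]_y f (U om, y).
Proof.
move=> mU mX XF it H bf; apply: Rintegral_indep => // A B mA mB.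
rewrite -XF//; apply: indep_of1 => //.
by apply: H => // j; rewrite inE => /eqP ->.
Qed.

End IndepOff.

(** * Second moment of the centered sum over pairs *)

(** A single sum over a finite type of pairs lets the square of the sum expand into a double sum
    over pairs. *)
Lemma sum_pairs_ord (V : nmodType) (n : nat) (g : nat -> nat -> V) :
  \sum_(1 <= j < n) \sum_(j.+1 <= k < n) g j k =
  \sum_(p : 'I_n * 'I_n | (1 <= p.1)%N && (p.1 < p.2)%N) g p.1 p.2.
Proof.
rewrite big_geq_mkord; under eq_bigr do rewrite big_geq_mkord.
by rewrite pair_big_dep.
Qed.

Lemma sum_eq_ord_fst (n : nat) (x : 'I_n) :
  (\sum_(q : 'I_n * 'I_n) (x == q.1) = n)%N.
Proof.
rewrite -(pair_bigA _ (fun i j : 'I_n => nat_of_bool (x == i)))/=.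
rewrite (bigD1 x)//= [X in (_ + X)%N]big1 => [|i ix].
  by rewrite eqxx sum_nat_const card_ord addn0 muln1.
by rewrite big1// => j _; rewrite eq_sym (negbTE ix).
Qed.

Lemma sum_eq_ord_snd (n : nat) (x : 'I_n) :
  (\sum_(q : 'I_n * 'I_n) (x == q.2) = n)%N.
Proof.
rewrite -(pair_bigA _ (fun i j : 'I_n => nat_of_bool (x == j)))/=.
rewrite exchange_big (bigD1 x)//= [X in (_ + X)%N]big1 => [|i ix].
  by rewrite eqxx sum_nat_const card_ord addn0 muln1.
by rewrite big1// => j _; rewrite eq_sym (negbTE ix).
Qed.

Section UStatistic.
Context {d} {Omega : measurableType d} {R : realType} (P : probability Omega R)
  (F : probability R R) (X : nat -> Omega -> R) (Z : Omega -> R).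
Hypotheses (mX : forall i, measurable_fun setT (X i)) (mZ : measurable_fun setT Z).
Hypothesis XF : forall i A, measurable A -> P (X i @^-1` A) = F A.
Hypothesis ZX : indep_off P X Z [:: 0%N].
Variable h : R -> R -> R -> R.
Hypothesis bh : bounded_measurable (fun p : R * R * R => h p.1.1 p.1.2 p.2).
Hypothesis h01 : forall x y z, 0 <= h x y z <= 1.

Let theta (x : R) : R := \int[F]_z \int[F]_y h x y z.
Let a (j k : nat) (om : Omega) : R := h (Z om) (X j om) (X k om) - theta (Z om).

Lemma bounded_measurable_kernel_section (x z : R) :
  bounded_measurable (fun y => h x y z).
Proof.
apply: (bounded_measurable_comp (fun p : R * R * R => h p.1.1 p.1.2 p.2)
  (fun y : R => (x, y, z))) => //.
by apply: measurable_fun_pair => //; exact: measurable_fun_pair.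
Qed.

Lemma bounded_measurable_kernel_mean1 :
  bounded_measurable (fun p : R * R => \int[F]_y h p.1 y p.2).
Proof.
apply: (bounded_measurable_Rintegral F
  (fun p : (R * R) * R => h p.1.1 p.2 p.1.2)).
apply: (bounded_measurable_comp (fun p : R * R * R => h p.1.1 p.1.2 p.2)
  (fun p : R * R * R => (p.1.1, p.2, p.1.2))) => //.
apply: measurable_fun_pair => /=; [apply: measurable_fun_pair|] => //=.
- exact: (measurableT_comp measurable_fst).
- exact: (measurableT_comp measurable_snd).
Qed.

Lemma bounded_measurable_kernel_mean : bounded_measurable theta.
Proof.
apply: (bounded_measurable_Rintegral F (fun p : R * R => \int[F]_y h p.1 y p.2)).
exact: bounded_measurable_kernel_mean1.
Qed.

Lemma kernel_mean01 x : 0 <= theta x <= 1.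
Proof.
apply: Rintegral_bound01.
  apply: (bounded_measurable_comp (fun p : R * R => \int[F]_y h p.1 y p.2)
    (pair x)); [exact: pair1_measurable|exact: bounded_measurable_kernel_mean1].
move=> z; apply: Rintegral_bound01 => //; exact: bounded_measurable_kernel_section.
Qed.

Lemma bounded_measurable_centered j k : bounded_measurable (a j k).
Proof.
apply: bounded_measurableB.
  apply: (bounded_measurable_comp (fun p : R * R * R => h p.1.1 p.1.2 p.2)
    (fun om => (Z om, X j om, X k om))) => //.
  by apply: measurable_fun_pair => //; exact: measurable_fun_pair.
exact/bounded_measurable_comp/bounded_measurable_kernel_mean.
Qed.

Lemma centered_le1 j k om : `|a j k om| <= 1.
Proof.
have /andP[h0 h1] := h01 (Z om) (X j om) (X k om).
have /andP[t0 t1] := kernel_mean01 (Z om).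
by rewrite /a ler_norml; apply/andP; split; lra.
Qed.

(** Given [Z], [X j] and [X k], the variables [X j'] and [X k'] are still fresh, so the second
    factor averages to zero. The index [0] is listed because [Z] may be [X 0]. *)
Lemma centered_uncorrelated j k j' k' : uniq [:: j'; k'; k; j; 0%N] ->
  \int[P]_om (a j k om * a j' k' om) = 0.
Proof.
case/and5P=> j'n k'n kn jn _.
pose U om := (Z om, X j om, X k om).
have mU1 : measurable_fun setT (fun om => (Z om, X j om)) by exact: measurable_fun_pair.
have mU : measurable_fun setT U by exact: measurable_fun_pair.
have mUk : measurable_fun setT (fun om => (U om, X k' om)) by exact: measurable_fun_pair.
have iU : indep_off P X U [:: k; j; 0%N].
  by apply: indep_off_pair => //; apply: indep_off_pair.
have iUk : indep_off P X (fun om => (U om, X k' om)) [:: k'; k; j; 0%N].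
  exact: indep_off_pair.
pose c (u : R * R * R) := h u.1.1 u.1.2 u.2 - theta u.1.1.
(* The last coordinate stands for [X j'] and fills the middle slot of [h]: it is integrated out
   first, like the inner variable of [theta]. *)
pose f (p : (R * R * R) * R * R) := c p.1.1 * (h p.1.1.1.1 p.2 p.1.2 - theta p.1.1.1.1).
have mf1 : measurable_fun setT (fun p : (R * R * R) * R * R => p.1.1.1.1).
  exact: (measurableT_comp measurable_fst (measurableT_comp measurable_fst
   (measurableT_comp measurable_fst measurable_fst))).
have bc : bounded_measurable c.
  apply: bounded_measurableB => //.
  apply: (bounded_measurable_comp theta); last exact: bounded_measurable_kernel_mean.
  exact: (measurableT_comp measurable_fst).
have bf : bounded_measurable f.
  apply: bounded_measurableM.
    apply: bounded_measurable_comp => //; exact: (measurableT_comp measurable_fst).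
  apply: bounded_measurableB; last first.
    exact: (bounded_measurable_comp theta _ mf1 bounded_measurable_kernel_mean).
  apply: (bounded_measurable_comp (fun p : R * R * R => h p.1.1 p.1.2 p.2)
    (fun p : (R * R * R) * R * R => (p.1.1.1.1, p.2, p.1.2))) => //.
  apply: measurable_fun_pair; [exact: measurable_fun_pair|].
  exact: (measurableT_comp measurable_snd).
rewrite [LHS](Rintegral_indep_off P X F (fun om => (U om, X k' om)) j'
  [:: k'; k; j; 0%N] f)//; last exact: XF.
have bg := bounded_measurable_Rintegral F f bf.
rewrite (Rintegral_indep_off P X F U k' [:: k; j; 0%N]
  (fun p => \int[F]_y f (p, y)))//; last exact: XF.
rewrite -[RHS](Rintegral_prob_cst P 0); apply: eq_Rintegral => om _.
have bh1 z := bounded_measurable_kernel_section (Z om) z.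
have bm1 : bounded_measurable (fun z => \int[F]_y h (Z om) y z).
  apply: (bounded_measurable_comp (fun p : R * R => \int[F]_y h p.1 y p.2)
    (pair (Z om))); [exact: pair1_measurable|exact: bounded_measurable_kernel_mean1].
have bt := @bounded_measurable_cst _ R R (theta (Z om)).
have Ef z : \int[F]_y f (U om, z, y) =
    c (U om) * (\int[F]_y h (Z om) y z - theta (Z om)).
  rewrite /f /= RintegralZl//; last first.
    exact/bounded_measurable_integrable/bounded_measurableB.
  rewrite RintegralB//; try exact: bounded_measurable_integrable.
  by rewrite Rintegral_prob_cst.
under eq_Rintegral do rewrite Ef.
rewrite RintegralZl//; last first.
  exact/bounded_measurable_integrable/bounded_measurableB.
rewrite RintegralB//; try exact: bounded_measurable_integrable.
by rewrite Rintegral_prob_cst -/(theta (Z om)) subrr mulr0.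
Qed.
Let D (n : nat) (om : Omega) : R :=
  \sum_(1 <= j < n) \sum_(j.+1 <= k < n) a j k om.

(** Two index pairs without a common index contribute nothing, and any others at most one. Each of
    the four coincidences counted by [c] occurs for [n ^ 3] couples of pairs. *)
Lemma centered_second_moment n :
  \int[P]_om (D n om ^+ 2) <= (4 * n ^ 3)%:R.
Proof.
pose Q (p : 'I_n * 'I_n) := (1 <= p.1)%N && (p.1 < p.2)%N.
pose c (p q : 'I_n * 'I_n) : nat :=
  ((p.1 == q.1) + (p.1 == q.2) + ((p.2 == q.1) + (p.2 == q.2)))%N.
have bap (p q : 'I_n * 'I_n) :
    bounded_measurable (fun om => a p.1 p.2 om * a q.1 q.2 om).
  by apply: bounded_measurableM; exact: bounded_measurable_centered.
have le_c p q : Q p -> Q q -> \int[P]_om (a p.1 p.2 om * a q.1 q.2 om) <= (c p q)%:R.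
  move=> /andP[p1 p12] /andP[q1 q12].
  have [c0|] := posnP (c p q).
    rewrite c0; move/eqP: c0; rewrite /c !addn_eq0 !eqb0.
    move=> /andP[/andP[n11 n12] /andP[n21 n22]].
    rewrite centered_uncorrelated//= !inE !negb_or -!lt0n.
    rewrite p1 q1 (ltn_trans p1 p12) (ltn_trans q1 q12) (gtn_eqF p12) (ltn_eqF q12) /=.
    by rewrite ![val q.1 == _]eq_sym ![val q.2 == _]eq_sym n11 n12 n21 n22.
  move=> c1; apply: (@le_trans _ _ 1); last by rewrite ler1n.
  rewrite -(Rintegral_prob_cst P 1); apply: le_Rintegral => //.
  - exact: bounded_measurable_integrable.
  - exact/bounded_measurable_integrable/bounded_measurable_cst.
  move=> om _; apply: le_trans (ler_norm _) _; rewrite normrM.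
  by rewrite mulr_ile1// centered_le1.
under eq_Rintegral do rewrite /D sum_pairs_ord expr2 big_distrlr /=.
rewrite Rintegral_sum; last first.
  by move=> p; apply: bounded_measurable_sum => q; exact: bap.
under eq_bigr do rewrite Rintegral_sum//.
apply: (@le_trans _ _ (\sum_p \sum_q (c p q)%:R)).
  apply: (@le_trans _ _ (\sum_(p | Q p) \sum_(q | Q q) (c p q)%:R)).
    by apply: ler_sum => p Qp; apply: ler_sum => q Qq; exact: le_c.
  (* Dropping the constraint [Q] adds only nonnegative terms and leaves a plain count. *)
  rewrite big_mkcond /=; apply: ler_sum => p _.
  have [_|_] := boolP (Q p); last by apply: sumr_ge0.
  by rewrite big_mkcond /=; apply: ler_sum => q _; case: ifP.
under eq_bigr do rewrite -natr_sum.
rewrite -natr_sum ler_nat.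
under eq_bigr => p _ do rewrite /c !big_split /= !sum_eq_ord_fst !sum_eq_ord_snd.
rewrite sum_nat_const card_prod card_ord; apply: eq_leq; ring.
Qed.

End UStatistic.

(** * Almost sure convergence along the squares and between them *)

(** By monotone convergence the series of the [W m ^ 2] has expectation at most [C], so it is almost
    surely finite and its terms tend to zero. *)
Lemma ae_cvg0_summable_sqr {d} {Omega : measurableType d} {R : realType}
    (P : probability Omega R) (W : nat -> Omega -> R) (C : R) :
  (forall m, bounded_measurable (W m)) ->
  (forall N, \sum_(0 <= m < N) \int[P]_om (W m om ^+ 2) <= C) ->
  {ae P, forall om, W m om @[m --> \oo] --> 0}.
Proof.
move=> bW WC.
have bW2 m : bounded_measurable (fun om => W m om ^+ 2).
  by apply: (bounded_measurableM (W m) (W m)).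
pose f m om := (W m om ^+ 2)%:E.
have f0 m om : (0 <= f m om)%E by rewrite lee_fin sqr_ge0.
have mf m : measurable_fun setT (f m) by apply/measurable_EFinP; exact: (bW2 m).1.
have ifin m : (\int[P]_om f m om)%E \is a fin_num.
  by apply: integrable_fin_num => //; have := bounded_measurable_integrable P _ (bW2 m).
have sC : (\int[P]_om (\sum_(m <oo) f m om) <= C%:E)%E.
  rewrite integral_nneseries//; apply: lime_le.
    by apply: is_cvg_nneseries => m _ _; apply: integral_ge0.
  apply: nearW => N.
  rewrite (eq_bigr (fun m => (\int[P]_om (W m om ^+ 2))%:E)); last first.
    by move=> m _; exact/esym/fineK/ifin.
  by rewrite sumEFin lee_fin.
have msum : measurable_fun setT (fun om => \sum_(m <oo) f m om)%E.
  by apply: (@ge0_emeasurable_sum _ _ _ _ _ xpredT) => [m om _ _|m _].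
have sum0 om : (0 <= \sum_(m <oo) f m om)%E by apply: nneseries_ge0 => m _ _; exact: f0.
have isum : P.-integrable setT (fun om => \sum_(m <oo) f m om)%E.
  apply/integrableP; split => //.
  apply: le_lt_trans (ltry C); apply: le_trans sC.
  apply: ge0_le_integral => //.
  - exact: measurableT_comp.
  - by move=> om _; rewrite gee0_abs.
have := integrable_ae measurableT isum.
apply: filterS => om /(_ I) sfin.
have cv : cvgn (series (fun m => W m om ^+ 2)).
  apply: nondecreasing_is_cvgn.
    by apply/nondecreasing_seqP => n; rewrite seriesSr lerDl sqr_ge0.
  exists (fine (\sum_(m <oo) f m om)%E) => _ [n _ <-].
  rewrite -lee_fin fineK// /series/= -sumEFin.
  by apply: (@nneseries_lim_ge _ (fun m => f m om) xpredT) => m _ _; exact: f0.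
have W2 := cvg_series_cvg_0 cv.
apply/norm_cvg0P.
have -> : (fun m => `|W m om|) = (fun m => Num.sqrt (W m om ^+ 2)).
  by apply/funext => m; rewrite sqrtr_sqr.
rewrite -[X in _ --> X]sqrtr0.
exact: (cvg_comp _ _ W2 (@sqrt_continuous R 0)).
Qed.

(** For [(m + 1)^2 <= n < (m + 2)^2], monotonicity traps [u n / n ^ 2] between
    [u ((m + 1)^2) / (m + 2)^4] and [u ((m + 2)^2) / (m + 1)^4], and the ratio of consecutive
    squares tends to one. *)
Lemma cvg_square_indices {R : realType} (u : nat -> R) (c : R) :
  (forall n, 0 <= u n) -> (forall n, u n <= u n.+1) ->
  u (m.+1 ^ 2)%N / m.+1%:R ^+ 4 @[m --> \oo] --> c ->
  u n / n%:R ^+ 2 @[n --> \oo] --> c.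
Proof.
move=> u0 uS vc.
have u_nd : {homo u : m n / (m <= n)%N >-> m <= n}.
  exact/nondecreasing_seqP.
pose v m := u (m.+1 ^ 2)%N / m.+1%:R ^+ 4.
have h0 : @harmonic R m @[m --> \oo] --> 0 by exact: cvg_harmonic.
have h1 : @harmonic R m.+1 @[m --> \oo] --> 0 by rewrite (cvg_shiftS (@harmonic R)).
have vS : v m.+1 @[m --> \oo] --> c by rewrite (cvg_shiftS v).
(* Since [harmonic k] is [1 / (k + 1)], the factor is [((m + 1) / (m + 2))^4] and trades the
   denominator [(m + 1)^4] of [v m] for [(m + 2)^4]; [rc] does the reverse. *)
have lc : v m * (1 - @harmonic R m.+1) ^+ 4 @[m --> \oo] --> c.
  rewrite -[X in _ --> X]mulr1 -[X in _ * X](expr1n _ 4) -[X in X ^+ 4]subr0.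
  apply: cvgM => //; apply: (@cvg_comp _ _ _ _ (fun x : R => x ^+ 4));
    last exact: exprn_continuous.
  by apply: cvgB => //; exact: cvg_cst.
have rc : v m.+1 * (1 + @harmonic R m) ^+ 4 @[m --> \oo] --> c.
  rewrite -[X in _ --> X]mulr1 -[X in _ * X](expr1n _ 4) -[X in X ^+ 4]addr0.
  apply: cvgM => //; apply: (@cvg_comp _ _ _ _ (fun x : R => x ^+ 4));
    last exact: exprn_continuous.
  by apply: cvgD => //; exact: cvg_cst.
have sqP n : (0 < n)%N -> exists m, (m.+1 ^ 2 <= n < m.+2 ^ 2)%N.
  elim: n => // -[_ _|n /(_ isT) [m /andP[m1 m2]] _]; first by exists 0%N.
  have [lt|ge] := ltnP n.+2 (m.+2 ^ 2); first by exists m; rewrite lt (leq_trans m1).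
  by exists m.+1; rewrite ge /= (leq_ltn_trans m2)// ltn_exp2r.
apply/cvgrPdist_lt => e e0.
move/cvgrPdist_lt : lc => /(_ _ e0) [N1 _ lc].
move/cvgrPdist_lt : rc => /(_ _ e0) [N2 _ rc].
(* From this threshold on, [n < (m + 2)^2] forces [m] to be at least [N1] and [N2]. *)
exists ((maxn N1 N2).+1 ^ 2)%N => // n /= Nn.
have n0 : (0 < n)%N by apply: leq_trans Nn; rewrite expn_gt0.
have [m /andP[m1 m2]] := sqP n n0.
have Nm : (maxn N1 N2 <= m)%N.
  by have := leq_ltn_trans Nn m2; rewrite ltn_exp2r// ltnS.
have {lc} := lc m (leq_trans (leq_maxl _ _) Nm).
have {rc} := rc m (leq_trans (leq_maxr _ _) Nm).
have rn : (0 : R) < n%:R by rewrite ltr0n.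
have rm1 : (0 : R) < m.+1%:R by rewrite ltr0n.
have rm2 : (0 : R) < m.+2%:R by rewrite ltr0n.
have le1 : v m * (1 - @harmonic R m.+1) ^+ 4 <= u n / n%:R ^+ 2.
  have -> : v m * (1 - @harmonic R m.+1) ^+ 4 = u (m.+1 ^ 2)%N / m.+2%:R ^+ 4.
    rewrite /v /harmonic /=; have -> : m.+1%:R = m.+2%:R - 1 :> R.
      by rewrite -[m.+2]addn1 natrD addrK.
    field; rewrite gt_eqF//= subr_eq0 -(@natrB R _ 1)//= gt_eqF//.
  apply: ler_pM => //; first exact: u_nd.
  rewrite lef_pV2 ?posrE ?exprn_gt0// -!natrX ler_nat (expnM _ 2 2).
  by rewrite leq_exp2r// ltnW.
have le2 : u n / n%:R ^+ 2 <= v m.+1 * (1 + @harmonic R m) ^+ 4.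
  have -> : v m.+1 * (1 + @harmonic R m) ^+ 4 = u (m.+2 ^ 2)%N / m.+1%:R ^+ 4.
    rewrite /v /harmonic /=; have -> : m.+2%:R = m.+1%:R + 1 :> R.
      by rewrite -[m.+2]addn1 natrD.
    have m0 : (0 : R) <= m%:R by rewrite ler0n.
    by field; apply/andP; split; apply: lt0r_neq0; lra.
  apply: ler_pM => //; first exact/u_nd/ltnW.
  by rewrite lef_pV2 ?posrE ?exprn_gt0// -!natrX ler_nat (expnM _ 2 2) leq_exp2r.
by rewrite !ltr_norml => /andP[? ?] /andP[? ?]; apply/andP; split; lra.
Qed.

(** * Strong law for the kernel sums *)

Lemma sum_pairsS {V : nmodType} (n : nat) (g : nat -> nat -> V) :
  \sum_(1 <= j < n.+1) \sum_(j.+1 <= k < n.+1) g j k =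
  \sum_(1 <= j < n) \sum_(j.+1 <= k < n) g j k + \sum_(1 <= j < n) g j n.
Proof.
case: n => [|n]; first by rewrite !big_geq// addr0.
rewrite big_nat_recr//= [X in _ + X]big_geq// addr0 -big_split/=.
by apply: eq_big_nat => j /andP[_ jn]; rewrite big_nat_recr.
Qed.

(** Written at [n.+1], this is the number [n (n - 1) / 2] of pairs from [1..n], free of truncated
    subtraction. *)
Lemma sum_pairs1 {R : realType} (n : nat) :
  \sum_(1 <= j < n.+1) \sum_(j.+1 <= k < n.+1) (1 : R) = (n%:R ^+ 2 - n%:R) / 2.
Proof.
elim: n => [|n IH]; first by rewrite big_geq// expr0n subrr mul0r.
rewrite sum_pairsS IH sumr_const_nat subn1 /= -natr1; by field.
Qed.

Lemma ae_foralln {d} {T : measurableType d} {R : realType}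
    (mu : {measure set T -> \bar R}) (Q : nat -> T -> Prop) :
  (forall j, {ae mu, forall x, Q j x}) -> {ae mu, forall x, forall j, Q j x}.
Proof.
move=> H; have := negligible_bigcup H.
apply: negligibleS => x /= /existsNP [j nQ].
by exists j.
Qed.

Section LimitTheorems.
Context {d} {Omega : measurableType d} {R : realType} (P : probability Omega R)
  (F : probability R R) (X : nat -> Omega -> R) (Z : Omega -> R).
Hypotheses (mX : forall i, measurable_fun setT (X i)) (mZ : measurable_fun setT Z).
Hypothesis XF : forall i A, measurable A -> P (X i @^-1` A) = F A.
Hypothesis ZX : indep_off P X Z [:: 0%N].

(** The factor one half in the limit appears because the number of pairs is asymptotic to
    [n ^ 2 / 2]. *)
Lemma ustatistic_strong_law (h : R -> R -> R -> R) :
  bounded_measurable (fun p : R * R * R => h p.1.1 p.1.2 p.2) ->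
  (forall x y z, 0 <= h x y z <= 1) ->
  {ae P, forall om,
    (\sum_(1 <= j < n) \sum_(j.+1 <= k < n) h (Z om) (X j om) (X k om)) / n%:R ^+ 2
      @[n --> \oo] --> (\int[F]_z \int[F]_y h (Z om) y z) / 2}.
Proof.
move=> bh h01.
pose theta x := \int[F]_z \int[F]_y h x y z.
pose D n om := \sum_(1 <= j < n) \sum_(j.+1 <= k < n)
  (h (Z om) (X j om) (X k om) - theta (Z om)).
have bD n : bounded_measurable (D n).
  apply: bounded_measurable_sum => j; apply: bounded_measurable_sum => k.
  exact: (bounded_measurable_centered F X Z mX mZ h bh j k).
(* For [n = (m + 1)^2] the normalization [n ^ 2] is [(m + 1)^4], so the second moment is at most
   [4 (m + 1)^6 / (m + 1)^8]. *)
pose W m om := D (m.+1 ^ 2)%N om * (m.+1%:R ^+ 4)^-1.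
have WD m : \int[P]_om (W m om ^+ 2) <= 4 / m.+1%:R ^+ 2.
  under eq_Rintegral do rewrite exprMn.
  rewrite RintegralZr//; last first.
    apply: (bounded_measurable_integrable P).
    exact: (bounded_measurableM (D (m.+1 ^ 2)%N) (D (m.+1 ^ 2)%N)).
  have D2 := centered_second_moment P F X Z mX mZ XF ZX h bh h01 (m.+1 ^ 2)%N.
  apply: le_trans (ler_wpM2r _ D2) _; first by rewrite sqr_ge0.
  rewrite natrM !natrX le_eqVlt; apply/orP; left; apply/eqP.
  have m0 : (0 : R) <= m%:R by rewrite ler0n.
  by field; apply: lt0r_neq0; lra.
(* Telescoping through [4 / (x + 1)^2 <= 4 / x - 4 / (x + 1)]; the constant [8] gives equality at
   the first term. *)
have sumW N : \sum_(0 <= m < N.+1) 4 / m.+1%:R ^+ 2 <= (8 : R) - 4 / N.+1%:R.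
  elim: N => [|N IH]; first by rewrite big_nat1 expr1n divr1; lra.
  rewrite big_nat_recr//=; apply: le_trans (lerD IH (lexx _)) _.
  have N0 : (0 : R) <= N%:R by rewrite ler0n.
  have -> : N.+2%:R = N.+1%:R + 1 :> R by rewrite natr1.
  have x0 : (0 : R) < N.+1%:R by rewrite ltr0n.
  set x := N.+1%:R in x0 *.
  rewrite -subr_ge0 (_ : _ - _ = 4 / (x * (x + 1) ^+ 2)); last first.
    by field; apply/andP; split; apply: lt0r_neq0; lra.
  by rewrite divr_ge0// mulr_ge0 ?sqr_ge0// ltW.
have aeW : {ae P, forall om, W m om @[m --> \oo] --> 0}.
  apply: (ae_cvg0_summable_sqr P W 8) => [m|N].
    apply: bounded_measurableM => //; exact: bounded_measurable_cst.
  apply: (@le_trans _ _ (\sum_(0 <= m < N) 4 / m.+1%:R ^+ 2)).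
    by apply: ler_sum => m _; exact: WD.
  apply: (@le_trans _ _ (\sum_(0 <= m < N.+1) 4 / m.+1%:R ^+ 2)).
    by rewrite big_nat_recr//= lerDl divr_ge0// sqr_ge0.
  by apply: le_trans (sumW N) _; rewrite gerBl divr_ge0.
apply: filterS aeW => om W0.
apply: (cvg_square_indices (fun n => \sum_(1 <= j < n) \sum_(j.+1 <= k < n)
   h (Z om) (X j om) (X k om))).
- move=> n; apply: sumr_ge0 => j _; apply: sumr_ge0 => k _.
  by case/andP: (h01 (Z om) (X j om) (X k om)).
- move=> n; rewrite sum_pairsS lerDl; apply: sumr_ge0 => j _.
  by case/andP: (h01 (Z om) (X j om) (X n om)).
have UD n : \sum_(1 <= j < n.+1) \sum_(j.+1 <= k < n.+1) h (Z om) (X j om) (X k om) =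
    D n.+1 om + theta (Z om) * ((n%:R ^+ 2 - n%:R) / 2).
  rewrite -sum_pairs1 big_distrr -big_split /=; apply: eq_bigr => j _.
  rewrite big_distrr -big_split /=; apply: eq_bigr => k _.
  by rewrite mulr1 subrK.
(* With [N = (m + 1)^2] there are [(N - 1) (N - 2) / 2] pairs; divided by [N ^ 2] this is
   [1 / 2 - 3 / (2 N) + 1 / N ^ 2], where [1 / N] is [harmonic m ^ 2]. *)
rewrite (_ : (fun m => _) = (fun m => W m om + theta (Z om) *
    (1 / 2 - 3 / 2 * (@harmonic R m ^+ 2) + @harmonic R m ^+ 4))); last first.
  apply/funext => m; rewrite /W.
  have -> : (m.+1 ^ 2)%N = (m.+1 ^ 2).-1.+1 by rewrite prednK ?expn_gt0.
  rewrite UD /harmonic /= mulrDl; congr (_ + _).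
  have -> : (m.+1 ^ 2).-1%:R = m.+1%:R ^+ 2 - 1 :> R.
    by rewrite -subn1 natrB ?expn_gt0// natrX.
  have m0 : (0 : R) <= m%:R by rewrite ler0n.
  by field; apply: lt0r_neq0; lra.
have h0 : @harmonic R m @[m --> \oo] --> 0 by exact: cvg_harmonic.
rewrite [X in _ --> X](_ : _ = 0 + theta (Z om) *
    (1 / 2 - 3 / 2 * 0 ^+ 2 + 0 ^+ 4)); last first.
  by rewrite -/(theta _) !expr0n /=; field.
have hX k : @harmonic R m ^+ k @[m --> \oo] --> (0 : R) ^+ k.
  exact: (@cvg_comp _ _ _ _ (fun x : R => x ^+ k) _ _ _ h0 (@exprn_continuous _ _ _)).
apply: cvgD => //; apply: cvgM; first exact: cvg_cst.
apply: cvgD => //; apply: cvgB; first exact: cvg_cst.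
by apply: cvgM => //; exact: cvg_cst.
Qed.

(** * Edges, wedges and the clustering coefficient *)

Variables (fc : R -> R -> R) (B : set R) (w : R).
Hypotheses (mfc : measurable_fun setT (fun p : R * R => fc p.1 p.2))
  (mB : measurable B).

Let b (p : R * R) : R := hD fc B p.1 p.2.

Lemma bounded_measurable_edge : bounded_measurable b.
Proof.
split; first by apply: (measurableT_comp _ mfc); exact: measurable_indic.
exists 1 => p; rewrite /b /hD indicE.
by case: (_ \in _); rewrite ?normr1 ?normr0.
Qed.

Lemma edge01 x y : 0 <= hD fc B x y <= 1.
Proof. by rewrite /hD indicE; case: (_ \in _); rewrite lexx ler01. Qed.

Lemma bounded_measurable_edge_section x : bounded_measurable (hD fc B x).
Proof.
apply: (bounded_measurable_comp b (pair x)); first exact: pair1_measurable.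
exact: bounded_measurable_edge.
Qed.

Lemma bounded_measurable_edge_comp {d'} {S : measurableType d'} (u v : S -> R) :
  measurable_fun setT u -> measurable_fun setT v ->
  bounded_measurable (fun s => hD fc B (u s) (v s)).
Proof.
move=> mu mv; apply: (bounded_measurable_comp b (fun s => (u s, v s))).
  exact: measurable_fun_pair.
exact: bounded_measurable_edge.
Qed.

Lemma ED_ge0 x : 0 <= ED fc B F x.
Proof.
by apply: Rintegral_ge0 => y _; case/andP: (edge01 x y).
Qed.

(** [hV] is a function of [y] times a function of [z], so the double integral splits; this yields
    the denominator of [Clim]. *)
Lemma wedge_mean x : \int[F]_z \int[F]_y hV fc B x y z = ED fc B F x ^+ 2.
Proof.
have bx := bounded_measurable_edge_section x.
under eq_Rintegral => z _.
  rewrite (_ : \int[F]_y hV fc B x y z = ED fc B F x * hD fc B x z); last first.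
    by rewrite /hV RintegralZr//; exact: (bounded_measurable_integrable F).
  over.
by rewrite RintegralZl//; exact: (bounded_measurable_integrable F).
Qed.

(** On the set [N] where [ED] vanishes, integrating out the fresh [X j] first gives zero, so a
    nonnegative function of [(Z, X j)] has zero expectation. Positivity of [j] keeps [X j] fresh
    even when [Z] is [X 0]. *)
Lemma ae_edge_zero j : (0 < j)%N ->
  {ae P, forall om, ED fc B F (Z om) = 0 -> hD fc B (Z om) (X j om) = 0}.
Proof.
move=> j0.
have bED : bounded_measurable (ED fc B F).
  apply: (bounded_measurable_Rintegral F b); exact: bounded_measurable_edge.
pose N := ED fc B F @^-1` [set 0].
have mN : measurable N.
  by rewrite /N -[X in measurable X]setTI; apply: bED.1.
(* The indicator [hD] equals its square; the square is kept so that [f] is a second moment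
   integrand, as in [ae_cvg0_summable_sqr]. *)
pose f (p : R * R) := \1_N p.1 * hD fc B p.1 p.2 ^+ 2.
have bf : bounded_measurable f.
  apply: bounded_measurableM.
    apply: (bounded_measurable_comp (\1_N) fst) => //; split.
      exact: measurable_indic.
    by exists 1 => x; rewrite indicE; case: (_ \in _); rewrite ?normr1 ?normr0.
  by apply: (bounded_measurableM b b); exact: bounded_measurable_edge.
have If : \int[P]_om f (Z om, X j om) = 0.
  rewrite (Rintegral_indep_off P X F Z j [:: 0%N] f)//; last 2 first.
    by move=> A mA; exact: XF.
    by rewrite inE -lt0n.
  rewrite -[RHS](Rintegral_prob_cst P 0); apply: eq_Rintegral => om _.
  rewrite /f /=.
  under eq_Rintegral => y _.
    rewrite (_ : hD _ _ _ _ ^+ 2 = hD fc B (Z om) y); last first.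
      by rewrite /hD indicE; case: (_ \in _); rewrite ?expr1n ?expr0n.
    over.
  rewrite RintegralZl//; last first.
    exact/(bounded_measurable_integrable F)/bounded_measurable_edge_section.
  rewrite indicE; case: (boolP (_ \in _)); last by rewrite mul0r.
  move=> /set_mem E0; rewrite -[X in _ * X]/(ED fc B F (Z om)).
  by rewrite (E0 : ED fc B F (Z om) = 0) mulr0.
(* A constant sequence: its convergence to 0 says that it vanishes. *)
pose W (_ : nat) om := \1_N (Z om) * hD fc B (Z om) (X j om).
have Wf m om : W m om ^+ 2 = f (Z om, X j om).
  by rewrite /W /f exprMn /= indicE; case: (_ \in _); rewrite ?expr1n ?expr0n.
have aeW : {ae P, forall om, W m om @[m --> \oo] --> 0}.
  apply: (ae_cvg0_summable_sqr P W 0) => [m|n].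
    apply: bounded_measurableM; last exact: bounded_measurable_edge_comp.
    apply: (bounded_measurable_comp (\1_N) Z) => //; split; first exact: measurable_indic.
    by exists 1 => x; rewrite indicE; case: (_ \in _); rewrite ?normr1 ?normr0.
  rewrite big1// => m _; rewrite -[RHS]If; apply: eq_Rintegral => om _; exact: Wf.
apply: filterS aeW => om W0 E0.
have : W 0%N om = 0 by apply: cvg_unique W0; [exact: Rhausdorff|exact: cvg_cst].
by rewrite /W indicE mem_set// mul1r.
Qed.

Lemma local_clustering_cvg :
  {ae P, forall om, Cn fc B w n (fun i => X i om) (Z om) @[n --> \oo]
    --> Clim fc B w F (Z om)}.
Proof.
have mp1 : measurable_fun setT (fun p : R * R * R => p.1.1).
  exact: (measurableT_comp measurable_fst).
have mp2 : measurable_fun setT (fun p : R * R * R => p.1.2).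
  exact: (measurableT_comp measurable_snd).
have h01 := edge01.
have TC : {ae P, forall om, Tn fc B n (fun i => X i om) (Z om) / n%:R ^+ 2
    @[n --> \oo] --> ET fc B F (Z om) / 2}.
  apply: (ustatistic_strong_law (hT fc B)) => [|x y z].
    apply: bounded_measurableM; first apply: bounded_measurableM;
      exact: bounded_measurable_edge_comp.
  have /andP[? ?] := h01 x y; have /andP[? ?] := h01 y z; have /andP[? ?] := h01 z x.
  by rewrite /hT !mulr_ge0//= !mulr_ile1// mulr_ge0.
have VC : {ae P, forall om, Vn fc B n (fun i => X i om) (Z om) / n%:R ^+ 2
    @[n --> \oo] --> ED fc B F (Z om) ^+ 2 / 2}.
  have bV : bounded_measurable (fun p : R * R * R => hV fc B p.1.1 p.1.2 p.2).
    by apply: bounded_measurableM; exact: bounded_measurable_edge_comp.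
  have V01 x y z : 0 <= hV fc B x y z <= 1.
    have /andP[? ?] := h01 x y; have /andP[? ?] := h01 x z.
    by rewrite /hV mulr_ge0//= mulr_ile1.
  apply: filterS (ustatistic_strong_law (hV fc B) bV V01) => om.
  by rewrite wedge_mean.
(* The shift to [j.+1] skips index [0], the vertex itself; countably many null sets are discarded to
   treat all [j] at once. *)
have EC : {ae P, forall om, forall j, ED fc B F (Z om) = 0 ->
    hD fc B (Z om) (X j.+1 om) = 0}.
  by apply: ae_foralln => j; exact: ae_edge_zero.
apply: filterS3 TC VC EC => om Tc Vc Ec.
rewrite /Cn /Clim.
have [E0|En0] := eqVneq (ED fc B F (Z om)) 0.
  (* The quotient by zero in [Clim] is killed by its indicator, leaving [w]; [Cn] also equals [w]
     for every [n], since every wedge uses an edge at the vertex. *)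
  rewrite E0 ltxx mulr0 add0r mulr1.
  have V0 n : Vn fc B n (fun i => X i om) (Z om) = 0.
    rewrite /Vn big_nat big1// => -[|j] // _; rewrite big1// => k _.
    by rewrite /hV -[\1_B _]/(hD fc B (Z om) (X j.+1 om)) Ec// mul0r.
  under eq_fun do rewrite V0 eqxx ler10 mulr0 add0r mulr1.
  exact: cvg_cst.
have E0 : 0 < ED fc B F (Z om) by rewrite lt_def En0 ED_ge0.
rewrite E0 mulr0 addr0 mulr1.
have V2 : 0 < ED fc B F (Z om) ^+ 2 / 2 by rewrite divr_gt0// exprn_gt0.
rewrite (_ : ET _ _ _ _ / _ = (ET fc B F (Z om) / 2) /
    (ED fc B F (Z om) ^+ 2 / 2)); last first.
  by field; rewrite En0.
(* Dividing both sums by [n ^ 2] leaves the quotient unchanged once [n] and [Vn] are nonzero, so the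
   two sequences agree eventually. *)
apply: cvg_trans (_ : (Tn fc B n (fun i => X i om) (Z om) / n%:R ^+ 2) /
  (Vn fc B n (fun i => X i om) (Z om) / n%:R ^+ 2) @[n --> \oo] --> _); last first.
  apply: cvgM => //; apply: cvgV => //; exact: lt0r_neq0.
have [e e0 Vge] : exists2 e : R, 0 < e & \forall n \near \oo,
    e <= Vn fc B n (fun i => X i om) (Z om) / n%:R ^+ 2.
  (* Half of the positive limit of [Vn / n ^ 2]. *)
  exists (ED fc B F (Z om) ^+ 2 / 2 / 2); first by rewrite divr_gt0.
  by apply: (cvgr_ge _ Vc); lra.
apply: near_eq_cvg.
near=> n.
have n0 : (0 : R) < n%:R by rewrite ltr0n; near: n; exact: nbhs_infty_gt.
(* Once [n >= 1 / e] and [n >= 1], one has [e n ^ 2 >= e n >= 1], so the indicator of [Vn >= 1] is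
   one. *)
have V1 : 1 <= Vn fc B n (fun i => X i om) (Z om).
  have en : e^-1 <= n%:R by near: n; exact: nbhs_infty_ger.
  have n1 : (1 : R) <= n%:R by near: n; exact: nbhs_infty_ger.
  have : e * n%:R ^+ 2 <= Vn fc B n (fun i => X i om) (Z om).
    by rewrite -ler_pdivlMr ?exprn_gt0//; near: n.
  apply: le_trans; rewrite -[leLHS](mulfV (lt0r_neq0 e0)).
  rewrite ler_pM2l//; apply: le_trans en _.
  by rewrite expr2 ler_peMl// ltW.
have V0 : Vn fc B n (fun i => X i om) (Z om) != 0 by rewrite gt_eqF// (lt_le_trans _ V1).
rewrite V1 (negbTE V0) mulr0 addr0 mulr1.
by field; rewrite V0 gt_eqF.
Unshelve. all: by end_near.
Qed.

End LimitTheorems.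

(** * The random and the deterministic choice of the vertex *)

(** Mutual independence takes one family of sets, so [A] is merged into [B] at the index [i], which
    does not occur in [s]. *)
Lemma mutually_independent_indep_off {d} {Omega : measurableType d}
    {R : realType} (P : probability Omega R) (X : nat -> Omega -> R) (i : nat) :
  mutually_independent_rv P X -> indep_off P X (X i) [:: i].
Proof.
move=> iX s us si A B mA mB.
have i_s : i \notin s by apply/negP => /si; rewrite inE eqxx.
have mC j : measurable (if j == i then A else B j) by case: ifP.
have := iX (i :: s) (fun j => if j == i then A else B j).
rewrite /= i_s us => /(_ isT mC); rewrite !big_cons eqxx.
have jB j : j \in s -> (if j == i then A else B j) = B j.
  by move=> js; case: eqP i_s => // <-; rewrite js.
rewrite [X in P (_ `&` X)](eq_big_seq (fun j => X j @^-1` B j)) => [|j /jB -> //].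
rewrite [X in (_ * X)%E](eq_big_seq (fun j => P (X j @^-1` B j))) => [//|j /jB -> //].
Qed.

(** The preimage of [A] under a constant is everything or empty: either the claim is mutual
    independence itself, or both sides vanish. *)
Lemma cst_indep_off {d} {Omega : measurableType d} {R : realType}
    (P : probability Omega R) (X : nat -> Omega -> R) (x : R) (t : seq nat) :
  mutually_independent_rv P X -> indep_off P X (fun _ => x) t.
Proof.
move=> iX s us _ A B mA mB; rewrite preimage_cst; case: ifP => _.
  by rewrite setTI iX// [X in (X * _)%E]probability_setT mul1e.
by rewrite set0I measure0 mul0e.
Qed.

Theorem theorem2 (R : realType) (d : measure_display) (Omega : measurableType d)
    (P : probability Omega R) (F : probability R R) (X : nat -> Omega -> R)
    (fc : R -> R -> R) (B : set R) (w : R) :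
  iid_with_law P F X ->
  measurable_fun setT (fun p : R * R => fc p.1 p.2) ->
  (forall x y, fc x y = fc y x) ->
  measurable B ->
  (forall x : R,
     {ae P, forall om,
        Cn fc B w n (fun i => X i om) x @[n --> \oo] --> Clim fc B w F x}) /\
  {ae P, forall om,
     Cn fc B w n (fun i => X i om) (X 0%N om) @[n --> \oo]
       --> Clim fc B w F (X 0%N om)}.
Proof.
move=> [mX iX XF] mfc _ mB; split=> [x|].
  apply: (local_clustering_cvg P F X (fun _ => x)) => //.
  exact: cst_indep_off.
apply: (local_clustering_cvg P F X (X 0%N)) => //.
exact: mutually_independent_indep_off.
Qed.
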